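(* Let $d, D_\Phi, M \ge 1$ be integers with $D_\Phi \ge d$, let $\beta>0$ and $\alpha\in[1,2]$, let $\Xi=[\xi_1,\dots,\xi_M]\in\mathbb{R}^{d\times M}$, and let $W\in\mathbb{R}^{D_\Phi\times d}$ have full rank. Put $\Phi(u)=Wu$ and $\mathcal{K}(u,v)=\langle \Phi(u),\Phi(v)\rangle=u^{\mathsf T}W^{\mathsf T}Wv$ for $u,v\in\mathbb{R}^d$, and $\mathcal{K}(\Xi,x)=(\mathcal{K}(\xi_1,x),\dots,\mathcal{K}(\xi_M,x))\in\mathbb{R}^M$. Define the energy $$E_{\mathcal K}(x)=\tfrac12\,\mathcal{K}(x,x)-\Psi^\star_\alpha\big(\beta,\mathcal{K}(\Xi,x)\big),\qquad x\in\mathbb{R}^d .$$ Then $E_{\mathcal K}$ is monotonically decreased by the retrieval dynamics $$\mathcal{T}_{\mathcal K}(x)=\Xi\cdot \mathrm{Sep}_\alpha\big(\beta,\mathcal{K}(\Xi,x)\big),$$ i.e. $E_{\mathcal K}(\mathcal{T}_{\mathcal K}(x))\le E_{\mathcal K}(x)$ for every $x\in\mathbb{R}^d$.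
   Context: Let $\Delta^M=\{p\in\mathbb{R}^M: p_\mu\ge 0,\ \sum_{\mu=1}^M p_\mu=1\}$. The Tsallis entropy is $\Psi_\alpha(p)=\frac{1}{\alpha(\alpha-1)}\sum_{\mu=1}^M(p_\mu-p_\mu^\alpha)$ for $\alpha\neq1$ and $\Psi_1(p)=-\sum_{\mu=1}^M p_\mu\ln p_\mu$ (with $0\ln 0=0$). For $z\in\mathbb{R}^M$, $\alpha\text{-EntMax}(z)=\operatorname{argmax}_{p\in\Delta^M}[\langle p,z\rangle+\Psi_\alpha(p)]$. For $\alpha=1$ this is $\mathrm{Softmax}(z)$, and for $\alpha=2$ it is $\mathrm{Sparsemax}(z)$, the Euclidean projection of $z$ onto $\Delta^M$. The separation function is $\mathrm{Sep}_\alpha(\beta,z)=\alpha\text{-EntMax}(\beta z)$; thus $\mathrm{Sep}_1(\beta,z)=\mathrm{Softmax}(\beta z)$ and $\mathrm{Sep}_2(\beta,z)=\mathrm{Sparsemax}(\beta z)$. The function $\Psi^\star_\alpha(\beta,\cdot):\mathbb{R}^M\to\mathbb{R}$ is: for $\alpha=1$, $\Psi^\star_1(\beta,z)=\frac1\beta\log\sum_{\mu=1}^M e^{\beta z_\mu}$; for $\alpha=2$, $\Psi^\star_2(\beta,z)=\frac1\beta\big(\frac12\|\beta z\|^2-\frac12\|z^\star-\beta z\|^2+\frac12\big)$ with $z^\star=\mathrm{Sparsemax}(\beta z)$; for general $\alpha\in[1,2]$, $\Psi^\star_\alpha(\beta,\cdot)=\int \alpha\text{-EntMax}(\beta z)\,dz$,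 i.e. a function whose gradient in $z$ is $\alpha\text{-EntMax}(\beta z)$ (the formulas for $\alpha=1,2$ are instances; the additive constant is immaterial). *)

(* Defs.v *)
From HB Require Import structures.
From mathcomp Require Import all_boot all_order all_algebra.
From mathcomp Require Import all_classical all_reals all_analysis.

Set Implicit Arguments.
Unset Strict Implicit.
Unset Printing Implicit Defensive.

Import Order.TTheory GRing.Theory Num.Theory.
Import numFieldNormedType.Exports.

Local Open Scope classical_set_scope.
Local Open Scope ring_scope.

(* Column vectors 'cV[R]_n carry the sup norm in the library, so the Euclidean
   inner product and norm are given explicitly; the notion of differentiability
   does not depend on this choice of norm. *)
Definition dot (R : realType) (n : nat) (u v : 'cV[R]_n) : R :=
  \sum_(i < n) u i ord0 * v i ord0.

Definition sqnorm (R : realType) (n : nat) (u : 'cV[R]_n) : R := dot u u.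

Definition simplex (R : realType) (M : nat) : set 'cV[R]_M :=
  [set p | (forall mu, 0 <= p mu ord0) /\ \sum_(mu < M) p mu ord0 = 1].

(* The conventions 0 ln 0 = 0 and 0^alpha = 0 (alpha <> 0) hold for the library's
   [ln] and [`^]. *)
Definition tsallis (R : realType) (M : nat) (alpha : R) (p : 'cV[R]_M) : R :=
  if alpha == 1 then - \sum_(mu < M) p mu ord0 * ln (p mu ord0)
  else (alpha * (alpha - 1))^-1 *
       \sum_(mu < M) (p mu ord0 - p mu ord0 `^ alpha).

Definition argmax (R : realType) (T : Type) (A : set T) (f : T -> R) : set T :=
  [set p | A p /\ forall q, A q -> f q <= f p].

(* For M >= 1 and 1 <= alpha <= 2 the objective is continuous and strictly
   concave on the compact simplex, so the argmax is a singleton and the default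
   value 0 of [xget] is never taken. *)
Definition entmax (R : realType) (M : nat) (alpha : R) (z : 'cV[R]_M) :
    'cV[R]_M :=
  xget 0 (argmax (@simplex R M) (fun p => dot p z + tsallis alpha p)).

Definition sparsemax (R : realType) (M : nat) (z : 'cV[R]_M) : 'cV[R]_M :=
  entmax 2 z.

Definition sep (R : realType) (M : nat) (alpha beta : R) (z : 'cV[R]_M) :
    'cV[R]_M :=
  entmax alpha (beta *: z).

Definition has_gradient (R : realType) (n : nat) (F : 'cV[R]_n -> R)
    (G : 'cV[R]_n -> 'cV[R]_n) : Prop :=
  forall z, differentiable F z /\ forall v, 'd F z v = dot (G z) v.

Definition psi_star1 (R : realType) (M : nat) (beta : R) (z : 'cV[R]_M) : R :=
  beta^-1 * ln (\sum_(mu < M) expR (beta * z mu ord0)).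

Definition psi_star2 (R : realType) (M : nat) (beta : R) (z : 'cV[R]_M) : R :=
  let zstar := sparsemax (beta *: z) in
  beta^-1 * (2^-1 * sqnorm (beta *: z) - 2^-1 * sqnorm (zstar - beta *: z)
             + 2^-1).

(* Psi*_alpha(beta, .) is only determined up to an additive constant, hence a
   predicate: any antiderivative of z |-> alpha-EntMax(beta z) qualifies, and so
   do, by definition, the closed forms for alpha = 1 and alpha = 2 (which are
   such antiderivatives). *)
Definition is_psi_star (R : realType) (M : nat) (alpha beta : R)
    (Psi : 'cV[R]_M -> R) : Prop :=
  [\/ alpha = 1 /\ Psi =1 psi_star1 beta,
      alpha = 2 /\ Psi =1 psi_star2 beta
    | has_gradient Psi (sep alpha beta)].

Definition feature (R : realType) (D d : nat) (W : 'M[R]_(D, d))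
    (u : 'cV[R]_d) : 'cV[R]_D :=
  W *m u.

Definition kernel (R : realType) (D d : nat) (W : 'M[R]_(D, d))
    (u v : 'cV[R]_d) : R :=
  dot (feature W u) (feature W v).

(* The memories xi_mu are the columns of Xi. *)
Definition kernel_vec (R : realType) (D d M : nat) (W : 'M[R]_(D, d))
    (Xi : 'M[R]_(d, M)) (x : 'cV[R]_d) : 'cV[R]_M :=
  \col_(mu < M) kernel W (col mu Xi) x.

Definition energy (R : realType) (D d M : nat) (W : 'M[R]_(D, d))
    (Xi : 'M[R]_(d, M)) (Psi : 'cV[R]_M -> R) (x : 'cV[R]_d) : R :=
  2^-1 * kernel W x x - Psi (kernel_vec W Xi x).

Definition retrieval (R : realType) (D d M : nat) (W : 'M[R]_(D, d))
    (Xi : 'M[R]_(d, M)) (alpha beta : R) (x : 'cV[R]_d) : 'cV[R]_d :=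
  Xi *m sep alpha beta (kernel_vec W Xi x).

(* Main.v *)
Require Import Defs.
From HB Require Import structures.
From mathcomp Require Import all_boot all_order all_algebra.
From mathcomp Require Import all_classical all_reals all_analysis.
From mathcomp Require Import ring lra.

(* Convex-concave descent.  If p = Sep(beta, z) is a subgradient of Psi at
   z = K(Xi, x), then linearity of K turns <p, K(Xi, y)> into K(Xi p, y), and with
   y = Xi p the energy difference is bounded by
     K(y,y)/2 - K(x,x)/2 - (K(y,y) - K(y,x)) = - |W(y - x)|^2 / 2 <= 0.
   For alpha = 1, 2 the closed form of beta Psi is the value function
   z |-> max_p (<p, beta z> + Psi_alpha(p)), for which the maximiser is a
   subgradient.  In general the maximiser is a monotone function of z, and a
   function with a monotone gradient lies above its tangents by the mean value
   theorem; the maximisers exist by compactness of the simplex. *)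

Set Implicit Arguments.
Unset Strict Implicit.
Unset Printing Implicit Defensive.

Import Order.TTheory GRing.Theory Num.Theory.
Local Open Scope ring_scope.

Import numFieldNormedType.Exports.

(** * Euclidean inner product *)

Lemma dotC (R : realType) n (u v : 'cV[R]_n) : dot u v = dot v u.
Proof. by apply: eq_bigr => i _; rewrite mulrC. Qed.

Lemma dotBr (R : realType) n (w u v : 'cV[R]_n) :
  dot w (u - v) = dot w u - dot w v.
Proof.
by rewrite /dot -sumrB; apply: eq_bigr => i _; rewrite !mxE mulrBr.
Qed.

Lemma dotBl (R : realType) n (w u v : 'cV[R]_n) :
  dot (u - v) w = dot u w - dot v w.
Proof. by rewrite dotC dotBr !(dotC w). Qed.

Lemma dotZr (R : realType) n a (u v : 'cV[R]_n) : dot u (a *: v) = a * dot u v.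
Proof.
by rewrite /dot mulr_sumr; apply: eq_bigr => i _; rewrite !mxE mulrCA.
Qed.

Lemma sqnorm_ge0 (R : realType) n (u : 'cV[R]_n) : 0 <= sqnorm u.
Proof. by apply: sumr_ge0 => i _; rewrite -expr2 sqr_ge0. Qed.

Lemma sqnormB (R : realType) n (u v : 'cV[R]_n) :
  sqnorm (u - v) = sqnorm u - 2 * dot u v + sqnorm v.
Proof. by rewrite /sqnorm dotBl !dotBr (dotC v u); ring. Qed.

(** * Energy decrease from a subgradient inequality *)

Section Kernel.
Context (R : realType) (D d M : nat) (W : 'M[R]_(D, d)) (Xi : 'M[R]_(d, M)).

Lemma kernel_sqnormB_ge0 u v :
  0 <= Defs.kernel W u u - 2 * Defs.kernel W u v + Defs.kernel W v v.
Proof. by rewrite /Defs.kernel -sqnormB sqnorm_ge0. Qed.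

Lemma dot_kernel_vec p x :
  dot p (kernel_vec W Xi x) = Defs.kernel W (Xi *m p) x.
Proof.
rewrite /Defs.kernel /feature mulmxA /dot.
under [RHS]eq_bigr do rewrite mxE mulr_suml.
rewrite exchange_big; apply: eq_bigr => mu _ /=.
rewrite [kernel_vec _ _ _ _ _]mxE mulr_sumr; apply: eq_bigr => i _.
rewrite mulrCA mulrA; congr (_ * _ * _).
by rewrite !mxE; apply: eq_bigr => j _; rewrite mxE.
Qed.

Lemma energy_descent (Psi : 'cV[R]_M -> R) p x :
    let z := kernel_vec W Xi x in
    (forall w, Psi z + dot p (w - z) <= Psi w) ->
  energy W Xi Psi (Xi *m p) <= energy W Xi Psi x.
Proof.
move=> z /(_ (kernel_vec W Xi (Xi *m p))).
rewrite dotBr !dot_kernel_vec /energy -/z => h.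
have := kernel_sqnormB_ge0 (Xi *m p) x; lra.
Qed.

End Kernel.

(** Along the segment from [z] to [w], the mean value theorem gives F w - F z = <G (z + c v), v>
    with v = w - z and 0 < c < 1. Monotonicity between z + c v and z, divided by c, bounds this
    below by <G z, v>. *)
Lemma has_gradient_monotone_subgradient (R : realType) n (F : 'cV[R]_n -> R)
    (G : 'cV[R]_n -> 'cV[R]_n) :
    has_gradient F G -> (forall u v, 0 <= dot (G u - G v) (u - v)) ->
  forall z w, F z + dot (G z) (w - z) <= F w.
Proof.
move=> FG Gmono z w; set v := w - z.
pose g (t : R) : R := F (z + t *: v).
have dg (t : R) : is_derive t (1 : R) g (dot (G (z + t *: v)) v).
  have [dF dFE] := FG (z + t *: v).
  have dl : differentiable (fun s : R => z + s *: v) t by [].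
  have dgt : differentiable g t by exact: differentiable_comp.
  apply: DeriveDef; first exact: diff_derivable.
  rewrite deriveE// /g -[fun t => _]/(F \o (fun s => z + s *: v)) diff_comp//=.
  by rewrite dFE diff_val /= !add0r scale1r.
have [|c] := @MVT R g _ 0 1 ltr01 (fun t _ => dg t).
  apply: continuous_subspaceT => t.
  apply/differentiable_continuous/derivable1_diffP.
  exact: (@ex_derive _ _ _ _ _ _ _ (dg t)).
rewrite in_itv/= => /andP[c0 _].
rewrite /g subr0 mulr1 scale1r scale0r addr0 /v subrKC.
have := Gmono (z + c *: v) z.
rewrite addrAC subrr add0r dotZr pmulr_rge0// dotBl /v; lra.
Qed.

(** * Tsallis entropies and their maximisers *)

Section TsallisEntropy.
Context (R : realType) (M : nat).
Implicit Types (p q z w : 'cV[R]_M) (alpha beta : R).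

Definition tsallis_argmax alpha z :=
  argmax (@simplex R M) (fun p => dot p z + tsallis alpha p).

Lemma tsallis1 p : tsallis 1 p = - \sum_(mu < M) p mu ord0 * ln (p mu ord0).
Proof. by rewrite /tsallis eqxx. Qed.

Lemma tsallis2 p : simplex p -> tsallis 2 p = 2^-1 - 2^-1 * sqnorm p.
Proof.
move=> [p0 p1]; rewrite /tsallis ifF; last by apply/eqP; lra.
rewrite (_ : 2 - 1 = 1)// ?mulr1; last by ring.
rewrite sumrB p1 mulrBr mulr1; congr (_ - _ * _).
by apply: eq_bigr => i _; rewrite powR_mulrn.
Qed.

Lemma dot_tsallis1 p z :
  dot p z + tsallis 1 p =
  \sum_(mu < M) p mu ord0 * (z mu ord0 - ln (p mu ord0)).
Proof.
by rewrite tsallis1 -sumrB; apply: eq_bigr => i _; rewrite mulrBr.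
Qed.

Definition logsumexp z : R := ln (\sum_(mu < M) expR (z mu ord0)).

(** The normalisation sits in the exponent, so the logarithm of an entry can be read off
    directly. *)
Definition softmax z : 'cV[R]_M :=
  \col_mu expR (z mu ord0 - logsumexp z).

Section Softmax.
Hypothesis M_gt0 : (0 < M)%N.

Lemma sumexp_gt0 z : 0 < \sum_(mu < M) expR (z mu ord0).
Proof.
rewrite (bigD1 (Ordinal M_gt0))//= ltr_pwDl ?expR_gt0//.
by apply: sumr_ge0 => i _; exact: expR_ge0.
Qed.

Lemma softmax_simplex z : simplex (softmax z).
Proof.
split=> [mu|]; first by rewrite mxE expR_ge0.
under eq_bigr do rewrite mxE expRB.
by rewrite -mulr_suml lnK ?posrE ?sumexp_gt0// divff ?gt_eqF ?sumexp_gt0.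
Qed.

Lemma dot_tsallis1_softmax z :
  dot (softmax z) z + tsallis 1 (softmax z) = logsumexp z.
Proof.
rewrite dot_tsallis1.
have [_ s1] := softmax_simplex z.
rewrite -[RHS]mul1r -s1 mulr_suml; apply: eq_bigr => mu _.
by rewrite !mxE expRK subKr.
Qed.

(* Gibbs' inequality, from [1 + t <= expR t] at [t = ln (softmax z / p)]. *)
Lemma dot_tsallis1_le p z :
  simplex p -> dot p z + tsallis 1 p <= logsumexp z.
Proof.
move=> [p0 p1]; rewrite dot_tsallis1.
have [_ s1] := softmax_simplex z.
(* The slack [softmax z mu - p mu] in the entrywise bound sums to zero, both vectors being on the
   simplex. *)
suff : \sum_(mu < M) p mu ord0 * (z mu ord0 - ln (p mu ord0)) <=
    \sum_(mu < M) (p mu ord0 * logsumexp z + softmax z mu ord0 - p mu ord0).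
  by rewrite sumrB big_split/= -mulr_suml p1 s1 mul1r addrK.
apply: ler_sum => mu _; rewrite [softmax z _ _]mxE.
have := p0 mu; rewrite le_eqVlt => /predU1P[<-|pmu].
  by rewrite !mul0r add0r subr0 expR_ge0.
set t := z mu ord0 - logsumexp z.
have : p mu ord0 * (1 + (t - ln (p mu ord0))) <=
    p mu ord0 * expR (t - ln (p mu ord0)).
  by rewrite ler_pM2l// expR_ge1Dx.
rewrite expRB lnK// mulrCA divff ?gt_eqF// mulr1 /t; nra.
Qed.

Lemma tsallis1_argmax z : tsallis_argmax 1 z (softmax z).
Proof.
split; first exact: softmax_simplex.
by move=> q qs; rewrite dot_tsallis1_softmax dot_tsallis1_le.
Qed.

End Softmax.

Local Open Scope classical_set_scope.

(** * Existence of maximisers by compactness *)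

Lemma continuous_sum (T : topologicalType) n (F : 'I_n -> T -> R) :
  (forall i, continuous (F i)) -> continuous (fun x => \sum_(i < n) F i x).
Proof. by move=> cF; apply: continuous_big => //; exact: add_continuous. Qed.

(** A closed subset of the cube [0, 1]^M: an entry is at most the sum of all of them. Row vectors
    fit [rV_compact] and [EVT_max_rV]. *)
Lemma simplex_compact : compact [set p : 'rV[R]_M | simplex p^T].
Proof.
apply: (@subclosed_compact _ _
  [set v : 'rV[R]_M | forall i, `[0, 1]%classic (v ord0 i)]).
- rewrite (_ : [set _ | _] =
    (\bigcap_(i in setT)
      ((fun p : 'rV[R]_M => p ord0 i) @^-1` [set t | 0 <= t]))
    `&` ((fun p : 'rV[R]_M => \sum_(i < M) p ord0 i) @^-1` [set 1])); last first.
    apply/seteqP; split => p /= [p0 p1]; split=> [i|].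
    + by move=> _; have := p0 i; rewrite mxE.
    + by rewrite -p1; apply: eq_bigr => i _; rewrite mxE.
    + by rewrite mxE; exact: p0.
    + by rewrite -p1; apply: eq_bigr => i _; rewrite mxE.
  apply: closedI.
    apply: closed_bigI => i _; apply: closed_comp; last exact: closed_ge.
    by move=> p _; exact: coord_continuous.
  apply: closed_comp; last exact: closed_eq.
  by move=> p _; apply: continuous_sum => i; exact: coord_continuous.
- apply: (@rV_compact R _ (fun=> `[0, 1]%classic)) => i.
  exact: segment_compact.
- move=> p [p0 p1] i /=; have := p0 i; rewrite mxE in_itv/= => -> /=.
  rewrite -p1 (bigD1 i)//= mxE lerDl.
  by apply: sumr_ge0 => j _; exact: p0.
Qed.

(* The absolute value matters: [x `^ a] is 1 for [x < 0]. *)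
Lemma continuous_norm_powR alpha :
  1 <= alpha -> continuous (fun x : R => `|x| `^ alpha).
Proof.
move=> a1 x; have [->|x0] := eqVneq x 0.
  rewrite /continuous_at normr0 powR0 ?gt_eqF ?(lt_le_trans ltr01)//.
  suff : `|y| `^ alpha @[y --> (0 : R)] --> (0 : R) by [].
  apply/(@cvgr0Pnorm_le R R R (nbhs (0 : R))) => e e0; near=> y.
  rewrite ger0_norm ?powR_ge0//.
  have [->|y0] := eqVneq y 0.
    by rewrite normr0 powR0 ?ltW// gt_eqF// (lt_le_trans ltr01).
  (* For |y| at most 1 and an exponent at least 1, the power is bounded by |y|, which tends to 0. *)
  have y1 : `|y| <= 1 by near: y; exact: (@nbhs0_le R R).
  apply: (@le_trans _ _ `|y|); last by near: y; exact: (@nbhs0_le R R).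
  by apply: ge1r_powR => //; rewrite normr_gt0 y0.
apply: (@continuous_comp _ _ _ (fun y : R => `|y|) (fun y => y `^ alpha)).
  exact: norm_continuous.
apply/differentiable_continuous/derivable1_diffP.
by apply: derivable_powR; rewrite in_itv/= normr_gt0 x0.
Unshelve. all: by end_near. Qed.

Lemma tsallis_argmax_neq0 alpha z : (0 < M)%N -> 1 <= alpha ->
  tsallis_argmax alpha z !=set0.
Proof.
move=> M0 a1; have [->|aN1] := eqVneq alpha 1.
  by exists (softmax z); exact: tsallis1_argmax.
(* The absolute value makes [f] continuous everywhere, while on the simplex it is still the
   objective. *)
pose f (p : 'rV[R]_M) := \sum_(i < M) p ord0 i * z i ord0 +
  (alpha * (alpha - 1))^-1 * \sum_(i < M) (p ord0 i - `|p ord0 i| `^ alpha).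
have fE p : simplex p -> f p^T = dot p z + tsallis alpha p.
  move=> [p0 _]; rewrite /f /tsallis (negbTE aN1); congr (_ + _ * _).
    by apply: eq_bigr => i _; rewrite mxE.
  by apply: eq_bigr => i _; rewrite mxE ger0_norm.
have fcont : continuous f.
  have linear_part : continuous
      (fun q : 'rV[R]_M => \sum_(i < M) q ord0 i * z i ord0).
    apply: continuous_sum => i q; apply: continuousM.
      exact: coord_continuous.
    exact: cst_continuous.
  have power_part : continuous
      (fun q : 'rV[R]_M => \sum_(i < M) (q ord0 i - `|q ord0 i| `^ alpha)).
    apply: continuous_sum => i q.
    apply: (@continuous_comp _ _ _ (fun q : 'rV[R]_M => q ord0 i)
      (fun y : R => y - `|y| `^ alpha)); first exact: coord_continuous.
    apply: continuousB => //; exact: continuous_norm_powR.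
  move=> p; apply: (@continuousD R R _ _ _ p (linear_part p)).
  by apply: continuousM; [exact: cst_continuous | exact: power_part].
have [|p ps pmax] := @EVT_max_rV R M f _ _ simplex_compact
    (continuous_subspaceT fcont).
  (* Softmax serves here as a point of the simplex, to show it nonempty. *)
  by exists (softmax z)^T; rewrite /= trmxK; exact: softmax_simplex.
rewrite inE/= in ps; exists p^T; split => // q qs.
rewrite -!fE// trmxK; apply: pmax.
by rewrite inE/= trmxK.
Qed.

(** * The value function and its subgradients *)

Section EntMax.
Hypothesis M_gt0 : (0 < M)%N.

Lemma entmaxP alpha z :
  1 <= alpha -> tsallis_argmax alpha z (entmax alpha z).
Proof. by move=> a1; apply: xgetPex; exact: tsallis_argmax_neq0. Qed.

Lemma entmax_simplex alpha z : 1 <= alpha -> simplex (entmax alpha z).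
Proof. by move=> /entmaxP-/(_ z)[]. Qed.

(** The convex conjugate at [z] of the negative entropy on the simplex. *)
Definition entmax_value alpha z :=
  dot (entmax alpha z) z + tsallis alpha (entmax alpha z).

(** The maximiser at [z] competes in the problem at [w], where its objective changes by its inner
    product with w - z. *)
Lemma entmax_value_subgradient alpha z w : 1 <= alpha ->
  entmax_value alpha z + dot (entmax alpha z) (w - z) <= entmax_value alpha w.
Proof.
move=> a1; have [_ /(_ _ (entmax_simplex z a1))] := entmaxP w a1.
rewrite dotBr /entmax_value.
move: (entmax alpha z) (entmax alpha w) => p q; lra.
Qed.

(** Add the subgradient inequalities at beta z and beta w: the values cancel. *)
Lemma sep_monotone alpha beta z w : 0 < beta -> 1 <= alpha ->
  0 <= dot (sep alpha beta z - sep alpha beta w) (z - w).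
Proof.
move=> b0 a1; rewrite -(pmulr_rge0 _ b0) -dotZr scalerBr dotBl.
have := entmax_value_subgradient (beta *: z) (beta *: w) a1.
have := entmax_value_subgradient (beta *: w) (beta *: z) a1.
rewrite /sep; move: (entmax_value _ _) (entmax_value _ _) => Vw Vz.
move: (entmax _ _) (entmax _ _) => p q; rewrite !dotBr; lra.
Qed.

(** Softmax is a competitor attaining log-sum-exp, and Gibbs' inequality bounds the maximum by
    it. *)
Lemma psi_star1E beta z :
  psi_star1 beta z = beta^-1 * entmax_value 1 (beta *: z).
Proof.
have -> : psi_star1 beta z = beta^-1 * logsumexp (beta *: z).
  by rewrite /logsumexp; under [in RHS]eq_bigr do rewrite mxE.
congr (_ * _).
apply/le_anti/andP; split.
  have [_ /(_ _ (softmax_simplex M_gt0 (beta *: z)))] :=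
    entmaxP (beta *: z) (lexx 1).
  by rewrite dot_tsallis1_softmax.
by apply: dot_tsallis1_le => //; exact: entmax_simplex.
Qed.

(** Expanding |p - beta z|^2 cancels |beta z|^2 and leaves <p, beta z> - |p|^2 / 2 + 1/2. *)
Lemma psi_star2E beta z :
  psi_star2 beta z = beta^-1 * entmax_value 2 (beta *: z).
Proof.
have a1 : (1 : R) <= 2 by lra.
rewrite /psi_star2 /entmax_value /sparsemax.
have := entmax_simplex (beta *: z) a1; move: (entmax 2 _) => p ps.
by rewrite tsallis2// sqnormB; congr (_ * _); field.
Qed.

Lemma psi_star_subgradient alpha beta (Psi : 'cV[R]_M -> R) z w :
    0 < beta -> 1 <= alpha -> is_psi_star alpha beta Psi ->
  Psi z + dot (sep alpha beta z) (w - z) <= Psi w.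
Proof.
move=> b0 a1.
(* Shared by alpha = 1 and 2: the prefactor 1/beta cancels the beta from rescaling the argument. *)
have closed_form : Psi =1 (fun u => beta^-1 * entmax_value alpha (beta *: u)) ->
    Psi z + dot (sep alpha beta z) (w - z) <= Psi w.
  move=> PsiE; have := entmax_value_subgradient (beta *: z) (beta *: w) a1.
  rewrite !PsiE /sep -scalerBr dotZr.
  move: (entmax_value _ _) (entmax_value _ _) (entmax _ _) => Vw Vz p pV.
  by rewrite -(ler_pM2l b0) mulrDr !mulVKf ?gt_eqF.
case=> [[alphaE PsiE]|[alphaE PsiE]|PsiG].
- by apply: closed_form => u; rewrite PsiE psi_star1E alphaE.
- by apply: closed_form => u; rewrite PsiE psi_star2E alphaE.
- apply: has_gradient_monotone_subgradient => // u v.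
  exact: sep_monotone.
Qed.

End EntMax.
End TsallisEntropy.

Theorem theorem2p1 (R : realType) (d DPhi M : nat)
    (hd : (1 <= d)%N) (hD : (1 <= DPhi)%N) (hM : (1 <= M)%N)
    (hdD : (d <= DPhi)%N)
    (alpha beta : R) (hbeta : 0 < beta) (halpha : 1 <= alpha <= 2)
    (Xi : 'M[R]_(d, M)) (W : 'M[R]_(DPhi, d))
    (hW : \rank W = minn DPhi d)
    (Psi : 'cV[R]_M -> R) (hPsi : is_psi_star alpha beta Psi) :
  forall x : 'cV[R]_d,
    energy W Xi Psi (retrieval W Xi alpha beta x) <= energy W Xi Psi x.
Proof.
move=> x; apply: energy_descent => w.
by apply: psi_star_subgradient => //; case/andP: halpha.
Qed.
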